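(* Let $n\ge 2$ and let $\mathfrak{h}^3\oplus\mathbb{R}^{2n-3}$ be the real Lie algebra with basis $\{e_1,\ldots,e_{2n}\}$ and bracket relation $[e_1,e_2]=e_{2n}$. Let $P$ be the $n\times n$ permutation matrix $$P=\begin{pmatrix}0& I_{n-1}\\ 1&0\end{pmatrix},$$ i.e. $Pe_1=e_n$ and $Pe_i=e_{i-1}$ for $2\le i\le n$ (here $e_i$ being the standard basis of $\mathbb{R}^n$). A set of representatives $U$ for the action of $\mathbb{R}^\times\mathrm{Aut}(\mathfrak{h}^3\oplus\mathbb{R}^{2n-3})$ on $\Omega(\mathfrak{h}^3\oplus\mathbb{R}^{2n-3})$ is given by the matrices (2) if $n=2$, and by the matrices (1)--(3) if $n>2$: $$(1)\ \ I_{2n}+kE_{2,n+1},\qquad (2)\ \ \begin{pmatrix}I_n&0\\0&P\end{pmatrix}+kE_{2,n+1},\qquad (3)\ \ \begin{pmatrix}I_n&0\\0&P\end{pmatrix}+E_{3,n+1},$$ where $k\in\{0,1\}$.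
   Context: All brackets of basis vectors not determined by the listed one through antisymmetry are zero; $\mathfrak{h}^3\oplus\mathbb{R}^{2n-3}$ is the direct sum of the 3-dimensional Heisenberg Lie algebra and an abelian Lie algebra. The Lie algebra $\mathfrak{g}$ is identified with $\mathbb{R}^{2n}$ via the basis $\{e_1,\ldots,e_{2n}\}$. $E_{i,j}$ denotes the $2n\times 2n$ matrix with entry $1$ at position $(i,j)$ and $0$ elsewhere. $\Omega(\mathfrak{g})$ denotes the set of nondegenerate alternating bilinear forms ($2$-forms) on the vector space $\mathfrak{g}$ (not necessarily closed). The group $\mathrm{GL}(2n,\mathbb{R})$ acts on $\Omega(\mathfrak{g})$ by $g.\omega(\cdot,\cdot)=\omega(g^{-1}(\cdot),g^{-1}(\cdot))$. $\mathrm{Aut}(\mathfrak{g})$ is the group of Lie algebra automorphisms, and $\mathbb{R}^\times\mathrm{Aut}(\mathfrak{g})=\{c\phi\mid\phi\in\mathrm{Aut}(\mathfrak{g}),\ c\in\mathbb{R}\setminus\{0\}\}\subset\mathrm{GL}(2n,\mathbb{R})$, acting by restriction; $[\omega]$ denotes the orbit of $\omega$ under this group. Let $\{\varepsilon^i\}$ be the dual basis of $\{e_i\}$ and $\omega_0=\varepsilon^1\wedge\varepsilon^{n+1}+\cdots+\varepsilon^n\wedge\varepsilon^{2n}$. A subset $U\subset\mathrm{GL}(2n,\mathbb{R})$ is a set of representatives for the action of $\mathbb{R}^\times\mathrm{Aut}(\mathfrak{g})$ on $\Omega(\mathfrak{g})$ if the set of all orbits equals $\{[h.\omega_0]\mid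 h\in U\}$ (distinct elements of $U$ are not required to give distinct orbits). *)

(* Defs.v *)
From mathcomp Require Import all_boot all_order perm all_algebra.
From mathcomp Require Import classical_sets reals.
From mathcomp Require Import ring.

Set Implicit Arguments.
Unset Strict Implicit.
Unset Printing Implicit Defensive.

Import GRing.Theory.
Local Open Scope classical_set_scope.
Local Open Scope ring_scope.

(* Basis vectors, coordinates and elementary matrices are indexed by natural
   numbers starting at 1; an index that is 0 or too large gives 0. *)
Section Basis.
Variables (R : realType) (m : nat).

Definition basis_vec (i : nat) : 'cV[R]_m := \col_a (a.+1 == i)%:R.

Definition dual_basis (i : nat) (x : 'cV[R]_m) : R := ((basis_vec i)^T *m x) 0 0.

Definition Emx (i j : nat) : 'M[R]_m :=
  \matrix_(a, b) ((a.+1 == i) && (b.+1 == j))%:R.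

Definition wedge (f g : 'cV[R]_m -> R) (x y : 'cV[R]_m) : R :=
  f x * g y - f y * g x.

End Basis.

Section LieAlgebra.
Variables (R : realType) (m : nat).
Local Notation V := 'cV[R]_m.

Definition is_lie_bracket (br : V -> V -> V) : Prop :=
  [/\ bilinear_for *:%R *:%R br,
      (forall x, br x x = 0) &
      (forall x y z, br x (br y z) + br y (br z x) + br z (br x y) = 0)].

Definition GLset : set 'M[R]_m := [set g | g \in unitmx].

Definition Autset (br : V -> V -> V) : set 'M[R]_m :=
  [set phi | phi \in unitmx /\
             forall x y, phi *m br x y = br (phi *m x) (phi *m y)].

Definition RAutset (br : V -> V -> V) : set 'M[R]_m :=
  [set c *: phi | c in [set c : R | c != 0] & phi in Autset br].

Definition nondegenerate_form (w : V -> V -> R) : Prop :=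
  forall x, (forall y, w x y = 0) -> x = 0.

Definition Omega : set (V -> V -> R) :=
  [set w | [/\ bilinear_for *%R *%R w,
               (forall x, w x x = 0) & nondegenerate_form w]].

Definition act (g : 'M[R]_m) (w : V -> V -> R) : V -> V -> R :=
  fun x y => w (invmx g *m x) (invmx g *m y).

Definition orbit_RAut (br : V -> V -> V) (w : V -> V -> R) : set (V -> V -> R) :=
  [set act g w | g in RAutset br].

End LieAlgebra.

Section Representatives.
Variables (R : realType) (n : nat).
Local Notation V := 'cV[R]_(n + n).

Definition omega0 (x y : V) : R :=
  \sum_(1 <= i < n.+1) wedge (dual_basis i) (dual_basis (n + i)) x y.

Definition set_of_representatives (br : V -> V -> V) (U : set 'M[R]_(n + n)) : Prop :=
  U `<=` @GLset R (n + n) /\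
  [set orbit_RAut br w | w in @Omega R (n + n)] =
  [set orbit_RAut br (act h omega0) | h in U].

Definition heis_bracket (x y : V) : V :=
  wedge (dual_basis 1) (dual_basis 2) x y *: basis_vec R (n + n) (n + n).

Definition Pmx : 'M[R]_n := perm_mx (perm (@ordS_inj n)).

Definition IPmx : 'M[R]_(n + n) := block_mx 1%:M 0 0 Pmx.

End Representatives.

Section Checks.
Variable R : realType.

Lemma dual_basisE m (a : 'I_m) (x : 'cV[R]_m) : dual_basis a.+1 x = x a 0.
Proof.
rewrite /dual_basis mxE (bigD1 a) //= !mxE eqxx mul1r big1 ?addr0 // => b ba.
by rewrite !mxE eqSS -val_eqE in ba *; rewrite (negPf ba) mul0r.
Qed.

Lemma dual_basis_vec m (i j : nat) : (0 < i <= m)%N ->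
  dual_basis i (basis_vec R m j) = (i == j)%:R.
Proof. by case: i => // i im; rewrite (dual_basisE (Ordinal im)) mxE. Qed.

Lemma dual_basisP m i a (x y : 'cV[R]_m) :
  dual_basis i (a *: x + y) = a * dual_basis i x + dual_basis i y.
Proof. by rewrite /dual_basis mulmxDr -scalemxAr !mxE. Qed.

Lemma heis_bracket_basis n (i j : nat) : (2 <= n)%N ->
  heis_bracket (basis_vec R (n + n) i) (basis_vec R (n + n) j) =
  if (i == 1) && (j == 2) then basis_vec R (n + n) (n + n)
  else if (i == 2) && (j == 1) then - basis_vec R (n + n) (n + n) else 0.
Proof.
move=> n2; have n2' : (2 <= n + n)%N by rewrite (leq_trans n2) ?leq_addr.
rewrite /heis_bracket /wedge !dual_basis_vec ?n2' ?(ltnW n2') //.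
by case: i j => [|[|[|i]]] [|[|[|j]]] //=;
  rewrite ?mul0r ?mulr0 ?mul1r ?subrr ?subr0 ?sub0r ?scale0r ?scale1r ?scaleN1r.
Qed.

Lemma heis_bracket_is_lie n : (2 <= n)%N -> is_lie_bracket (@heis_bracket R n).
Proof.
move=> n2; have n2' : (2 < n + n)%N by rewrite (leq_trans _ (leq_add n2 n2)).
have z x y i : (i == 1) || (i == 2) -> dual_basis i (@heis_bracket R n x y) = 0.
  move=> i12; rewrite -[heis_bracket _ _]addr0 dual_basisP.
  have [i0 iN] : (0 < i)%N /\ (i < n + n)%N.
    by case/orP: i12 => /eqP->; split=> //; apply: ltnW.
  rewrite dual_basis_vec ?i0 ?(ltnW iN) // [dual_basis i 0]/dual_basis.
  by rewrite mulmx0 mxE addr0 ltn_eqF ?mulr0.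
split.
- split=> [y a x1 x2|x a y1 y2]; rewrite /= /heis_bracket /wedge !dual_basisP;
  rewrite scalerA -scalerDl; congr (_ *: _); ring.
- by move=> x; rewrite /heis_bracket /wedge subrr scale0r.
- have br0 x y u : heis_bracket u (heis_bracket x y) = 0 :> 'cV[R]_(n + n).
    by rewrite [LHS]/heis_bracket /wedge !z // mulr0 mul0r subrr scale0r.
  by move=> x y u; rewrite !br0 !addr0.
Qed.

Lemma Pmx_basis1 n : (0 < n)%N -> Pmx R n *m basis_vec R n 1 = basis_vec R n n.
Proof.
case: n => // n _; apply/colP=> a; rewrite /Pmx -row_permE !mxE permE /= !eqSS.
congr (nat_of_bool _)%:R; case: (ltngtP a n) => [an|na|->].
- by rewrite modn_small.
- by have := leq_trans na (ltn_ord a : a <= n)%N; rewrite ltnn.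
- by rewrite modnn.
Qed.

Lemma Pmx_basisS n (i : nat) : (0 < i < n)%N ->
  Pmx R n *m basis_vec R n i.+1 = basis_vec R n i.
Proof.
case: n => [|n]; first by rewrite ltn0 andbF.
move=> /andP[i0 iN]; apply/colP=> a; rewrite /Pmx -row_permE !mxE permE /= !eqSS.
congr (nat_of_bool _)%:R; case: (ltngtP a n) => [an|na|->].
- by rewrite modn_small.
- by have := leq_trans na (ltn_ord a : a <= n)%N; rewrite ltnn.
- by rewrite modnn ltn_eqF // gtn_eqF.
Qed.

Lemma omega0_basis n (i j : nat) : (0 < i <= n)%N -> (0 < j <= n)%N ->
  omega0 (basis_vec R (n + n) i) (basis_vec R (n + n) (n + j)) = (i == j)%:R.
Proof.
move=> /andP[i0 iN] /andP[j0 jN]; rewrite /omega0 /wedge.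
rewrite (bigD1_seq i) /= ?mem_index_iota ?iota_uniq ?i0 ?ltnS //.
have h k : (0 < k <= n)%N -> (0 < k <= n + n)%N /\ (0 < n + k <= n + n)%N.
  by case/andP=> k0 kn; rewrite k0 addn_gt0 k0 orbT leq_add2l kn (leq_trans kn) ?leq_addr.
have [h1 h2] := h _ (introT andP (conj i0 iN)).
rewrite !dual_basis_vec // !eqxx mul1r eqn_add2l (@gtn_eqF i (n + i)) ?mulr0; last first.
  by rewrite -[X in (X < _)%N]add0n ltn_add2r (leq_trans i0).
rewrite subr0 big1_seq ?addr0 // => k /andP[ki].
rewrite mem_index_iota ltnS => /andP[k0 kn].
have [h3 h4] := h k (introT andP (conj k0 kn)).
rewrite !dual_basis_vec // (negPf ki) mul0r (@gtn_eqF i) ?mulr0 ?subrr //.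
by rewrite -[i]addn0 -addnS leq_add.
Qed.

End Checks.

(* Main.v *)
(* The group [R^x Aut] is the stabilizer of the flag D = <e_2n> < Z = <e_3, .., e_2n>:
   an automorphism must scale D by the determinant of its action on g/Z, and the
   scalar removes this constraint. So the orbits are the congruence classes of
   nondegenerate alternating forms together with this flag. By Witt's theorem they
   are told apart by the plane W = Z^perp: either the form is nonzero on W, or W is
   isotropic and contains D, or W is isotropic and does not contain D. The last case
   needs n > 2, since an isotropic W and D span an isotropic subspace. With M the
   matrix of the form and K its inverse, W is spanned by rows 1 and 2 of K, and the
   value of the form on W is the entry (1, 2) of K up to sign. The three cases are
   reached by (2) with k = 1, (2) with k = 0 and (1) with k = 0. *)
From HB Require Import structures.
Require Import Defs.
From mathcomp Require Import all_boot all_order all_algebra.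
From mathcomp Require Import classical_sets reals.
From mathcomp Require Import zify ring boolp.

Set Implicit Arguments.
Unset Strict Implicit.
Unset Printing Implicit Defensive.

Import GRing.Theory.
Local Open Scope classical_set_scope.
Local Open Scope ring_scope.

(** * Alternating matrices *)

Definition alternating (F : fieldType) (m : nat) (M : 'M[F]_m) : Prop :=
  forall v : 'rV[F]_m, v *m M *m v^T = 0.

Lemma trmx11 (F : fieldType) (A : 'M[F]_1) : A^T = A.
Proof. by apply/matrixP=> i j; rewrite mxE !ord1. Qed.

Lemma alternating_tr (F : fieldType) (m : nat) (M : 'M[F]_m) :
  alternating M -> M^T = - M.
Proof.
move=> altM; apply/matrixP=> i j; rewrite !mxE; apply/eqP.
have E (a b : 'I_m) : M a b = ((delta_mx 0 a : 'rV_m) *m M *m (delta_mx 0 b : 'rV_m)^T) 0 0.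
  by rewrite -rowE trmx_delta -colE !mxE.
have := altM (delta_mx 0 i + delta_mx 0 j).
rewrite !mulmxDl linearD /= !mulmxDr !altM addr0 add0r => /matrixP/(_ 0 0).
by rewrite mxE [RHS]mxE -!E => /eqP; rewrite addrC addr_eq0.
Qed.

Lemma row_free_col_mx (F : fieldType) (k m : nat) (A : 'M[F]_(k, m)) (v : 'rV_m) :
  row_free A -> ~~ (v <= A)%MS -> row_free (col_mx A v).
Proof.
move=> /eqP rA nvA; rewrite /row_free eqn_leq rank_leq_row -addsmxE.
have : (A < A + v)%MS.
  by rewrite ltmxE addsmxSl /=; apply: contra nvA; apply: submx_trans (addsmxSr _ _).
by move/rank_ltmx; rewrite rA addn1.
Qed.

(** * Witt's extension theorem for alternating forms, with vectors as rows *)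

Section Witt.
Variables (F : fieldType) (m : nat).
Implicit Types J : 'M[F]_m.

Lemma gram_col_mx k J (A : 'M[F]_(k, m)) (v : 'rV_m) : alternating J ->
  col_mx A v *m J *m (col_mx A v)^T =
  block_mx (A *m J *m A^T) (A *m J *m v^T) (- (A *m J *m v^T)^T) 0.
Proof.
move=> altJ; rewrite mul_col_mx tr_col_mx mul_col_row altJ; congr block_mx.
by rewrite !trmx_mul trmxK alternating_tr // mulNmx mulmxN opprK mulmxA.
Qed.

(** The row space of [kermx (J *m A^T)] is the orthogonal complement of [A], of dimension [m - k],
    and it meets [A] in dimension [k] minus the rank of the Gram matrix. So containment depends on
    the Gram matrix alone, and can be carried from one frame to another with the same Gram
    matrix. *)
Lemma orthogonal_complement_sub k J (A : 'M[F]_(k, m)) :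
  row_free A -> J \in unitmx -> alternating J ->
  (kermx (J *m A^T) <= A)%MS = (\rank (A *m J *m A^T) + m == k + k)%N.
Proof.
move=> /eqP rA uJ altJ.
have := mxrank_mul_ker A (J *m A^T); rewrite mulmxA rA => rG.
have rJA : \rank (J *m A^T) = k.
  by rewrite eqmxMfull ?mxrank_tr // row_full_unit.
have km : (k <= m)%N by rewrite -rA rank_leq_col.
have rK : \rank (kermx (J *m A^T)) = (m - k)%N by rewrite mxrank_ker rJA.
have := (mxrank_leqif_sup (capmxSr A (kermx (J *m A^T)))).2.
rewrite sub_capmx submx_refl andbT rK => <-.
by apply/eqP/eqP; lia.
Qed.

(* The vectors v' with the right Gram entries form a coset of the orthogonal
   complement of A'. If the coset lay inside the span of A', that complement would
   lie in it too; the rank criterion transfers this to A, and then v would be in the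
   span of A. *)
Lemma unit_alternating_extend k J J' (A A' : 'M[F]_(k, m)) :
  J \in unitmx -> J' \in unitmx -> alternating J -> alternating J' ->
  row_free A -> row_free A' -> A *m J *m A^T = A' *m J' *m A'^T -> (k < m)%N ->
  exists v v' : 'rV_m, [/\ row_free (col_mx A v), row_free (col_mx A' v') &
    col_mx A v *m J *m (col_mx A v)^T = col_mx A' v' *m J' *m (col_mx A' v')^T].
Proof.
move=> uJ uJ' altJ altJ' fA fA' eqG km.
have [v nvA] : exists v : 'rV_m, ~~ (v <= A)%MS.
  have : ~~ (1%:M <= A)%MS.
    by rewrite sub1mx /row_full (eqP fA) neq_ltn km.
  by case/row_subPn=> i; exists (row i 1%:M).
have [x xP nxA] : exists2 x : 'rV_m, A' *m J' *m x^T = A *m J *m v^T & ~~ (x <= A')%MS.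
  have fAJ : row_free (A' *m J') by rewrite /row_free mxrankMfree ?row_free_unit.
  pose x := (pinvmx (A' *m J') *m (A *m J *m v^T))^T.
  have xP : A' *m J' *m x^T = A *m J *m v^T by rewrite trmxK mulmxA mulmxVp ?mul1mx.
  have [xA|] := boolP (x <= A')%MS; last by exists x.
  have : ~~ (kermx (J' *m A'^T) <= A')%MS.
    rewrite orthogonal_complement_sub // -eqG -(orthogonal_complement_sub fA) //.
    have [c xE] := submxP xA.
    (* With [x = c *m A'], the equality of Gram matrices makes [v - c *m A] orthogonal to [A]. *)
    apply/negP => sKA; case/negP: nvA; rewrite -[v](subrK (c *m A)).
    apply: addmx_sub (submxMl _ _); apply: submx_trans sKA; apply/sub_kermxP.
    apply: trmx_inj; rewrite trmx0 !trmx_mul trmxK alternating_tr //.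
    rewrite mulmxN mulNmx linearB /= mulmxBr -xP xE !trmx_mul !mulmxA eqG.
    by rewrite subrr oppr0.
  case/row_subPn=> i; set y := row i _ => nyA; exists (x + y); last first.
    apply: contra nyA => sxy; rewrite -[y](addKr x) addmx_sub //.
    by rewrite eqmx_opp.
  have : y *m (J' *m A'^T) = 0 by apply/sub_kermxP/row_sub.
  move/(congr1 trmx); rewrite !trmx_mul trmxK trmx0 alternating_tr // mulmxN mulNmx.
  by move/eqP; rewrite oppr_eq0 linearD mulmxDr xP => /eqP ->; rewrite addr0.
exists v, x; split; try exact: row_free_col_mx.
by rewrite !gram_col_mx // xP eqG.
Qed.

(** Induction on the codimension [d]: both frames grow by one vector at a time, keeping equal Gram
    matrices, until they are bases. Then [invmx A' *m A] is the isometry. *)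
Theorem witt_alternating k J J' (A A' : 'M[F]_(k, m)) :
  J \in unitmx -> J' \in unitmx -> alternating J -> alternating J' ->
  row_free A -> row_free A' -> A *m J *m A^T = A' *m J' *m A'^T ->
  exists Q : 'M_m, [/\ Q \in unitmx, A' *m Q = A & Q *m J *m Q^T = J'].
Proof.
move=> uJ uJ' altJ altJ' fA fA' eqG.
have km : (k <= m)%N by rewrite -(eqP fA) rank_leq_col.
have [d dE] : exists d, (k + d = m)%N by exists (m - k)%N; rewrite subnKC.
elim: d k dE {km} A A' fA fA' eqG => [|d IHd] k dE A A' fA fA' eqG.
  rewrite addn0 in dE; subst k; move: fA fA'; rewrite !row_free_unit => uA uA'.
  exists (invmx A' *m A); split; first by rewrite unitmx_mul unitmx_inv uA' uA.
    by rewrite mulKVmx.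
  rewrite trmx_mul !mulmxA -(mulmxA _ A J) -(mulmxA _ _ A^T) eqG.
  by rewrite !mulmxA mulVmx // mul1mx trmx_inv mulmxK // unitmx_tr.
have [|v [v' [fv fv' eqv]]] := unit_alternating_extend uJ uJ' altJ altJ' fA fA' eqG.
  by rewrite -dE addnS ltnS leq_addr.
have [|Q [uQ AQ JQ]] := IHd _ _ _ _ fv fv' eqv; first by rewrite addn1 addSnnS.
by exists Q; split=> //; move: AQ; rewrite mul_col_mx => /eq_col_mx[].
Qed.
End Witt.

Lemma alternating_congr (F : fieldType) (k m : nat) (B : 'M[F]_(k, m)) (M : 'M[F]_m) :
  alternating M -> alternating (B *m M *m B^T).
Proof. by move=> altM v; rewrite !mulmxA -mulmxA -trmx_mul altM. Qed.

Lemma alternating_invmx (F : fieldType) (m : nat) (M : 'M[F]_m) :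
  M \in unitmx -> alternating M -> alternating (invmx M).
Proof.
move=> uM altM v; rewrite -[LHS]trmx11 -[RHS](altM (v *m invmx M)) !trmx_mul trmxK.
by rewrite -!mulmxA (mulKmx uM).
Qed.

Lemma invmx_mul (F : fieldType) (m : nat) (A B : 'M[F]_m) :
  A \in unitmx -> B \in unitmx -> invmx (A *m B) = invmx B *m invmx A.
Proof.
move=> uA uB; have uAB : A *m B \in unitmx by rewrite unitmx_mul uA.
by rewrite -[RHS](mulmxK uAB) !mulmxA mulmxKV // mulVmx // mul1mx.
Qed.

(** * Forms as matrices, and the group acting on them *)

Section MatrixForms.
Variables (R : realType) (m : nat).
Implicit Types (M g : 'M[R]_m) (w : 'cV[R]_m -> 'cV[R]_m -> R).

Definition mxform M (x y : 'cV[R]_m) : R := (x^T *m M *m y) 0 0.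

Lemma mxform_Omega M : M \in unitmx -> alternating M -> Omega (mxform M).
Proof.
move=> uM altM; split.
- split=> [y a x1 x2|x a y1 y2]; rewrite /mxform.
    by rewrite linearP /= !mulmxDl -!scalemxAl !mxE.
  by rewrite mulmxDr -scalemxAr !mxE.
- by move=> x; rewrite /mxform -{2}[x]trmxK altM mxE.
- move=> x x0; apply: trmx_inj; rewrite trmx0 -[LHS](mulmxK uM).
  suff -> : x^T *m M = 0 by rewrite mul0mx.
  apply/rowP=> j; have := x0 (delta_mx j 0); rewrite /mxform -colE mxE => ->.
  by rewrite mxE.
Qed.

Lemma Omega_mxform w : Omega w ->
  exists M, [/\ M \in unitmx, alternating M & w = mxform M].
Proof.
case=> -[linl linr] w0 nondeg.
pose M := \matrix_(i, j) w (delta_mx i 0) (delta_mx j 0).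
have wE : w = mxform M.
  (* The partial maps of [w] are repackaged as linear maps, so that [w] can be expanded over the
     standard basis with [linear_sum]. *)
  pose wl y : {linear 'cV[R]_m -> R^o} :=
    HB.pack (w^~ y) (GRing.isLinear.Build _ _ _ _ (w^~ y) (linl y)).
  pose wr x : {linear 'cV[R]_m -> R^o} :=
    HB.pack (w x) (GRing.isLinear.Build _ _ _ _ (w x) (linr x)).
  apply/funext=> x; apply/funext=> y; rewrite /mxform.
  have colE z : z = \sum_i z i 0 *: delta_mx i 0 :> 'cV[R]_m.
    by rewrite {1}[z]matrix_sum_delta; apply: eq_bigr => i _; rewrite big_ord1.
  rewrite mxE {1}[y]colE -[w _ _]/(wr x _) linear_sum; apply: eq_bigr => j _.
  rewrite linearZ /= mulrC; congr (_ * _); rewrite mxE {1}[x]colE.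
  rewrite -[w _ _]/(wl _ _) linear_sum; apply: eq_bigr => i _.
  by rewrite linearZ /= !mxE.
exists M; split=> //.
  rewrite -row_free_unit -kermx_eq0; apply/eqP/row_matrixP=> i; rewrite row0.
  apply: trmx_inj; rewrite trmx0; apply: nondeg => y.
  by rewrite wE /mxform trmxK -row_mul mulmx_ker row0 mul0mx mxE.
move=> v; apply/matrixP=> i j; rewrite !ord1.
by have := w0 v^T; rewrite wE /mxform trmxK => ->; rewrite mxE.
Qed.

Lemma act_mxform g M : act g (mxform M) = mxform ((invmx g)^T *m M *m invmx g).
Proof.
by apply/funext=> x; apply/funext=> y; rewrite /act /mxform trmx_mul !mulmxA.
Qed.

Lemma act_mul g h w : g \in unitmx -> h \in unitmx ->
  act (g *m h) w = act g (act h w).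
Proof.
move=> ug uh; apply/funext=> x; apply/funext=> y.
by rewrite /act invmx_mul // !mulmxA.
Qed.

Section Orbits.
Variable br : 'cV[R]_m -> 'cV[R]_m -> 'cV[R]_m.

Lemma RAutset_unit g : RAutset br g -> g \in unitmx.
Proof. by case=> c /= c0 [phi [uphi _]] <-; rewrite unitmxZ ?unitfE. Qed.

Lemma RAutset_mul g h : RAutset br g -> RAutset br h -> RAutset br (g *m h).
Proof.
case=> c /= c0 [phi [uphi phiE]] <-; case=> d /= d0 [psi [upsi psiE]] <-.
exists (c * d); first by rewrite /= mulf_neq0.
exists (phi *m psi); last by rewrite -scalemxAl -scalemxAr scalerA.
by split=> [|x y]; rewrite ?unitmx_mul ?uphi // -!mulmxA psiE phiE.
Qed.

Lemma RAutset_inv g : RAutset br g -> RAutset br (invmx g).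
Proof.
case=> c /= c0 [phi [uphi phiE]] <-.
exists c^-1; first by rewrite /= invr_neq0.
exists (invmx phi); last by rewrite invmxZ ?unitmxZ ?unitfE.
split=> [|x y]; first by rewrite unitmx_inv.
by rewrite -[in LHS](mulKVmx uphi x) -[in LHS](mulKVmx uphi y) -phiE mulKmx.
Qed.

Lemma orbit_RAut_act p w : RAutset br p -> orbit_RAut br (act p w) = orbit_RAut br w.
Proof.
move=> Ap; have up := RAutset_unit Ap; apply/seteqP; split=> _ [g Ag <-].
  by exists (g *m p); [exact: RAutset_mul | rewrite act_mul // RAutset_unit].
have Agp : RAutset br (g *m invmx p) by apply: RAutset_mul => //; apply: RAutset_inv.
by exists (g *m invmx p) => //; rewrite -act_mul ?RAutset_unit // mulmxKV.
Qed.

End Orbits.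
End MatrixForms.

(** * The flag stabilizer and equivalence of forms through frames *)

Section Flag.
Variables (R : realType) (m : nat) (i1 i2 iN : 'I_m).
Variable br : 'cV[R]_m -> 'cV[R]_m -> 'cV[R]_m.
Hypotheses (i12 : i1 != i2) (i1N : i1 != iN) (i2N : i2 != iN).
Hypothesis brE : forall x y,
  br x y = (x i1 0 * y i2 0 - y i1 0 * x i2 0) *: delta_mx iN 0.
Implicit Types M p : 'M[R]_m.

Local Notation e1 := (delta_mx 0 i1 : 'rV[R]_m).
Local Notation e2 := (delta_mx 0 i2 : 'rV[R]_m).
Local Notation eN := (delta_mx 0 iN : 'rV[R]_m).
(** The rows are the two coordinate functionals with common kernel Z. Hence [E *m p <= E] says that
    [p] preserves Z. *)
Let E : 'M[R]_(1 + 1, m) := col_mx e1 e2.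

Lemma sub_col_mxP (B C v : 'rV[R]_m) :
  (v <= col_mx B C)%MS -> exists x y : R, v = x *: B + y *: C.
Proof.
case/submxP=> D ->; exists (D 0 (lshift 1 0)), (D 0 (rshift 1 0)).
rewrite -[in LHS](hsubmxK D) mul_row_col [lsubmx D]mx11_scalar [rsubmx D]mx11_scalar.
by rewrite !mul_scalar_mx !mxE.
Qed.

(** Let [del] be the determinant of [p] on g/Z. Dividing [p] by [del] turns this determinant into
    [del^-1], and the fixed vector e_2n is then scaled by [del^-1] as well, so [del^-1 *: p]
    respects the bracket. *)
Lemma RAutset_of_flag p : p \in unitmx -> (E *m p <= E)%MS ->
  p *m delta_mx iN 0 = (delta_mx iN 0 : 'cV_m) -> RAutset br p.
Proof.
move=> up; rewrite mul_col_mx col_mx_sub.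
case/andP=> /sub_col_mxP[a [b e1p]] /sub_col_mxP[c [d e2p]] pN.
have coord i (x : 'cV[R]_m) : x i 0 = ((delta_mx 0 i : 'rV_m) *m x) 0 0 :> R by rewrite -rowE mxE.
have px i u v (x : 'cV[R]_m) : delta_mx 0 i *m p = u *: e1 + v *: e2 ->
    (p *m x) i 0 = u * x i1 0 + v * x i2 0.
  move=> ip; rewrite (coord i (p *m x)) mulmxA ip mulmxDl -!scalemxAl -!rowE.
  by rewrite !mxE.
set del := a * d - b * c.
have pbr x y : br (p *m x) (p *m y) = del *: br x y.
  rewrite !brE !(px _ _ _ _ e1p) !(px _ _ _ _ e2p) scalerA; congr (_ *: _).
  by rewrite /del; ring.
have brp x y : p *m br x y = br x y by rewrite brE -scalemxAr pN.
have del0 : del != 0.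
  apply/eqP=> del0.
  (* If [del] were zero, the bracket would vanish on the image of [p], which is everything, while
     the bracket of e_1 and e_2 is e_2n. *)
  have := pbr (invmx p *m delta_mx i1 0) (invmx p *m delta_mx i2 0).
  rewrite del0 scale0r !mulKVmx // brE !mxE !eqxx (negPf i12) mul0r subr0 mulr1.
  by rewrite scale1r => /matrixP/(_ iN 0)/eqP; rewrite !mxE !eqxx oner_eq0.
exists del => //; exists (del^-1 *: p); last by rewrite scalerA mulfV ?scale1r.
split=> [|x y]; first by rewrite unitmxZ ?unitfE ?invr_neq0.
rewrite -!scalemxAl brp.
transitivity (del^-1 * del^-1 *: br (p *m x) (p *m y)); last first.
  by rewrite !brE scalerA !mxE; congr (_ *: _); ring.
by rewrite pbr scalerA -mulrA mulVf // mulr1.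
Qed.

(** [X] and [Y] locate W and e_2n by their coordinates in the frames, so the Witt isometry [Q] fixes
    e_2n and matches the two planes W. As W is the orthogonal of Z, the column action [Q^T]
    preserves Z, and [RAutset_of_flag] applies. *)
Lemma RAut_equiv_of_frames k M M' (A A' : 'M[R]_(k, m)) (Y : 'rV_k) :
  M \in unitmx -> M' \in unitmx -> alternating M -> alternating M' ->
  row_free A -> row_free A' -> A *m M *m A^T = A' *m M' *m A'^T ->
  (exists2 X : 'M_(1 + 1, k),
    (E *m invmx M <= X *m A)%MS & (X *m A' <= E *m invmx M')%MS) ->
  Y *m A = eN -> Y *m A' = eN ->
  exists2 p, RAutset br p & act p (mxform M') = mxform M.
Proof.
move=> uM uM' altM altM' fA fA' eqG [X sX sX'] YA YA'.
have [Q [uQ AQ QM]] := witt_alternating uM uM' altM altM' fA fA' eqG.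
exists Q^T.
  apply: RAutset_of_flag; rewrite ?unitmx_tr //.
    have /submxP[C CE] : (E *m invmx M <= E *m invmx M' *m Q)%MS.
      by apply: submx_trans sX _; rewrite -AQ mulmxA submxMr.
    apply/submxP; exists C.
    rewrite -[E in LHS](mulmxKV uM) CE -!mulmxA (mulmxA Q M) QM.
    by rewrite mulVmx // mulmx1.
  apply: trmx_inj; rewrite trmx_mul trmxK !trmx_delta -[in LHS]YA' -mulmxA AQ.
  exact: YA.
rewrite act_mxform -QM trmx_inv trmxK.
congr mxform; rewrite !mulmxA mulVmx // mul1mx mulmxK //.
by rewrite unitmx_tr.
Qed.

(** * The plane W and its position relative to e_2n *)

Let W M : 'M[R]_(1 + 1, m) := E *m invmx M.

Lemma row_free_E : row_free E.
Proof.
rewrite row_free_col_mx //.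
  by rewrite /row_free mxrank_delta.
apply/negP=> /submxP[u /matrixP/(_ 0 i2)/eqP].
by rewrite mxE eqxx mxE big_ord1 !mxE eqxx /= (eq_sym i2) (negPf i12) mulr0 oner_eq0.
Qed.

Lemma row_free_W M : M \in unitmx -> row_free (W M).
Proof.
move=> uM; rewrite /row_free mxrankMfree ?row_free_unit ?unitmx_inv //.
exact: row_free_E.
Qed.

Lemma mulmx_form_eN (i : 'I_m) M : M \in unitmx -> i != iN ->
  delta_mx 0 i *m invmx M *m M *m eN^T = 0 :> 'M_1.
Proof. by move=> uM iN'; rewrite mulmxKV // trmx_delta mul_delta_mx_0. Qed.

(** The vector e_2n lies in Z, hence is orthogonal to W. On the span of W and e_2n the form is thus
    determined by its values on W. *)
Lemma W_form_eN M : M \in unitmx -> W M *m M *m eN^T = 0.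
Proof.
move=> uM; rewrite /W /E !mul_col_mx !mulmx_form_eN //.
by apply/eqP; rewrite col_mx_eq0 eqxx.
Qed.

(** With K the inverse of [M], K M K^T = K^T = -K, so the Gram matrix is minus the 2 by 2 block of K
    on the indices [i1], [i2]. *)
Lemma W_gram M : M \in unitmx -> alternating M ->
  W M *m M *m (W M)^T =
  block_mx 0 (- (invmx M i1 i2)%:M) (invmx M i1 i2)%:M 0.
Proof.
move=> uM altM; have altK := alternating_invmx uM altM.
rewrite /W trmx_mul mulmxKV // alternating_tr // mulNmx mulmxN mulmxA.
rewrite gram_col_mx // altK opp_block_mx !oppr0 opprK; congr block_mx.
  by congr (- _); rewrite trmx_delta -rowE -colE [LHS]mx11_scalar !mxE.
by rewrite trmx_delta -rowE -colE trmx11 [LHS]mx11_scalar !mxE.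
Qed.

(* Rescaling the first vector of the frame matches the two values of the form
   on [W M] and [W M']. *)
Lemma RAut_equiv_transverse M M' (c : R) :
  M \in unitmx -> M' \in unitmx -> alternating M -> alternating M' ->
  ~~ (eN <= W M)%MS -> ~~ (eN <= W M')%MS ->
  c != 0 -> c * invmx M i1 i2 = invmx M' i1 i2 ->
  exists2 p, RAutset br p & act p (mxform M') = mxform M.
Proof.
move=> uM uM' altM altM' nW nW' c0 eqc.
pose D : 'M[R]_(1 + 1) := block_mx c%:M 0 0 1%:M.
have uD : D \in unitmx.
  by rewrite unitmxE det_ublock det_scalar1 det1 mulr1 unitfE.
have DW : (D *m W M :=: W M)%MS by apply: eqmxMfull; rewrite row_full_unit.
apply: (@RAut_equiv_of_frames _ M M' (col_mx (D *m W M) eN) (col_mx (W M') eN)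
         (row_mx 0 1%:M)) => //.
- apply: row_free_col_mx; last by rewrite DW.
  by rewrite /row_free DW; exact: row_free_W.
- by apply: row_free_col_mx => //; exact: row_free_W.
- rewrite !gram_col_mx // -!(mulmxA D) !W_form_eN // mulmx0; congr block_mx.
  rewrite trmx_mul (mulmxA _ _ D^T) !W_gram // -eqc.
  rewrite /D tr_block_mx !mulmx_block !trmx0 !tr_scalar_mx.
  rewrite ?(mulmx0, mul0mx, mul1mx, mulmx1, addr0, add0r).
  by rewrite mulmxN mul_mx_scalar mul_scalar_mx !scale_scalar_mx mulrC.
- by exists (row_mx 1%:M 0); rewrite mul_row_col mul1mx mul0mx addr0 ?DW.
- by rewrite mul_row_col mul1mx mul0mx add0r.
- by rewrite mul_row_col mul1mx mul0mx add0r.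
Qed.

(** Exchange: e_2n is a combination of the two rows of [W M], and replaces one whose coefficient is
    nonzero. The other row is kept as [b]; being a row of the inverse with index other than [iN], it
    is orthogonal to e_2n. *)
Lemma W_frame M : M \in unitmx -> alternating M -> (eN <= W M)%MS ->
  exists b : 'rV[R]_m, [/\ row_free (col_mx b eN), (col_mx b eN == W M)%MS &
    col_mx b eN *m M *m (col_mx b eN)^T = 0].
Proof.
move=> uM altM sNW.
suff [b [i iN' ->] sub] : exists2 b : 'rV[R]_m,
    exists2 i, i != iN & b = delta_mx 0 i *m invmx M & (W M == col_mx b eN)%MS.
  exists (delta_mx 0 i *m invmx M); split.
  - by rewrite /row_free -(eqmxP sub); exact: row_free_W.
  - by rewrite andbC.
  - rewrite gram_col_mx // altM mulmx_form_eN // trmx0 oppr0.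
    exact: block_mx_const.
have e1W : (e1 *m invmx M <= W M)%MS by rewrite /W mul_col_mx -addsmxE addsmxSl.
have e2W : (e2 *m invmx M <= W M)%MS by rewrite /W mul_col_mx -addsmxE addsmxSr.
have gen (v w : 'rV[R]_m) (x y : R) : x != 0 -> eN = x *: v + y *: w ->
    (v <= col_mx w eN)%MS.
  move=> x0 eNE; have -> : v = x^-1 *: (eN - y *: w).
    by rewrite eNE addrK scalerA mulVf // scale1r.
  by rewrite scalemx_sub // addmx_sub ?eqmx_opp ?scalemx_sub // -addsmxE
    (addsmxSl, addsmxSr).
have [x [y]] : exists x y, eN = x *: (e1 *m invmx M) + y *: (e2 *m invmx M).
  by apply: sub_col_mxP; rewrite -mul_col_mx.
have sub (w : 'rV[R]_m) : (w <= col_mx w eN)%MS by rewrite -addsmxE addsmxSl.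
have [-> eNE|x0 eNE] := eqVneq x 0.
  have y0 : y != 0.
    apply/eqP=> y0; move: eNE; rewrite y0 !scale0r addr0 => /matrixP/(_ 0 iN)/eqP.
    by rewrite !mxE !eqxx oner_eq0.
  exists (e1 *m invmx M); first by exists i1.
  rewrite col_mx_sub e1W sNW /W mul_col_mx col_mx_sub sub (gen _ _ y 0) //.
  by rewrite scale0r addr0 eNE scale0r add0r.
exists (e2 *m invmx M); first by exists i2.
by rewrite col_mx_sub e2W sNW /W mul_col_mx col_mx_sub sub (gen _ _ x y).
Qed.

Lemma RAut_equiv_contained M M' :
  M \in unitmx -> M' \in unitmx -> alternating M -> alternating M' ->
  (eN <= W M)%MS -> (eN <= W M')%MS ->
  exists2 p, RAutset br p & act p (mxform M') = mxform M.
Proof.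
move=> uM uM' altM altM' /(W_frame uM altM)[b [fb /andP[_ sb] gb]].
move=> /(W_frame uM' altM')[b' [fb' /andP[sb' _] gb']].
apply: (RAut_equiv_of_frames (Y := row_mx 0 1%:M) uM uM' altM altM' fb fb').
- by rewrite gb gb'.
- by exists 1%:M; rewrite mul1mx.
- by rewrite mul_row_col mul1mx mul0mx add0r.
- by rewrite mul_row_col mul1mx mul0mx add0r.
Qed.

(** Here the form is nondegenerate on W, and e_2n is orthogonal to W, so e_2n in W would be zero. *)
Lemma W_nondegenerate_transverse M : M \in unitmx -> alternating M ->
  invmx M i1 i2 != 0 -> ~~ (eN <= W M)%MS.
Proof.
move=> uM altM t0; apply/negP=> /submxP[u eNE].
have eNW : eN *m M *m (W M)^T = 0.
  apply: trmx_inj; rewrite trmx0 trmx_mul trmxK trmx_mul alternating_tr // mulNmx mulmxN.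
  by rewrite mulmxA W_form_eN // oppr0.
have uG : W M *m M *m (W M)^T \in unitmx.
  rewrite W_gram // unitmxE unitfE; set t := invmx M i1 i2 in t0 *.
  suff : block_mx 0 (- t%:M) t%:M 0 *m block_mx 0 (t^-1)%:M (- (t^-1)%:M) 0 = 1%:M :> 'M[R]_(1 + 1).
    by move/mulmx1_unit=> []; rewrite unitmxE unitfE.
  rewrite mulmx_block !mulmx0 !mul0mx !addr0 !add0r mulNmx mulmxN opprK.
  by rewrite -scalar_mxM mulfV // -scalar_mx_block.
have u0 : u = 0 by rewrite -[u](mulmxK uG) 2!(mulmxA u) -eNE eNW mul0mx.
move: eNE; rewrite u0 mul0mx => /matrixP/(_ 0 iN)/eqP.
by rewrite !mxE !eqxx oner_eq0.
Qed.

(** Otherwise W and e_2n span an isotropic subspace of dimension 3, which forces [m] to be at least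
    6. *)
Lemma isotropic_W_contained M : M \in unitmx -> alternating M -> (m <= 4)%N ->
  invmx M i1 i2 = 0 -> (eN <= W M)%MS.
Proof.
move=> uM altM m4 t0; apply: contraTT m4 => nW.
have fA : row_free (col_mx (W M) eN) by rewrite row_free_col_mx ?row_free_W.
have : col_mx (W M) eN *m M *m (col_mx (W M) eN)^T = 0.
  rewrite gram_col_mx // W_form_eN // W_gram // t0 trmx0 !oppr0 raddf0.
  by rewrite oppr0 !block_mx0.
move/mulmx0_rank_max; rewrite mxrankMfree ?row_free_unit // mxrank_tr (eqP fA).
by rewrite -ltnNge; lia.
Qed.
End Flag.

(** * The standard form and its images under block matrices *)

Section StandardForm.
Variables (R : realType) (n : nat).
Implicit Types X Q : 'M[R]_n.

Definition Jmx : 'M[R]_(n + n) := block_mx 0 1%:M (- 1%:M) 0.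

Lemma omega0_mxform : @omega0 R n = mxform Jmx.
Proof.
apply/funext=> x; apply/funext=> y; rewrite /omega0 /mxform.
rewrite -[x in RHS](vsubmxK x) -[y in RHS](vsubmxK y) tr_col_mx /Jmx mul_row_block.
rewrite !mulmx0 add0r addr0 mulmxN !mulmx1 mul_row_col mulNmx !mxE -sumrN -big_split /=.
rewrite big_add1 big_mkord; apply: eq_bigr => i _.
rewrite /wedge addrC addnS -[i.+1]/((lshift n i).+1) -[(n + i).+1]/((rshift n i).+1).
by rewrite !dual_basisE !mxE; ring.
Qed.

Lemma alternating_Jmx : alternating Jmx.
Proof.
move=> v; rewrite -(hsubmxK v) tr_row_mx mul_row_block !mulmx0 add0r addr0 mulmxN.
rewrite !mulmx1 mul_row_col mulNmx -[X in - X + _]trmx11 trmx_mul trmxK.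
by rewrite addNr.
Qed.

Lemma mulmx_JmxN : Jmx *m - Jmx = 1%:M.
Proof.
rewrite mulmxN mulmx_block !mulmx0 !mul0mx !mulmxN !mulNmx mulmx1 !addr0 !add0r.
by rewrite opp_block_mx !opprK !oppr0 -scalar_mx_block.
Qed.

Lemma Jmx_unit : Jmx \in unitmx.
Proof. by have /mulmx1_unit[] := mulmx_JmxN. Qed.

Lemma invmx_Jmx : invmx Jmx = - Jmx.
Proof. by rewrite -[RHS](mulKmx Jmx_unit) mulmx_JmxN mulmx1. Qed.

(** All the listed representatives have this block shape. The inverse of the matrix of the form is h
    J^-1 h^T, where J is [Jmx], so it is read off without inverting h. *)
Lemma act_omega0 X Q : Q \in unitmx ->
  let h := block_mx 1%:M X 0 Q in
  h \in unitmx /\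
  exists M, [/\ M \in unitmx, alternating M, act h (@omega0 R n) = mxform M &
                invmx M = block_mx (X - X^T) (- Q^T) Q 0].
Proof.
move=> uQ h.
have uh : h \in unitmx by rewrite unitmxE det_ublock det1 mul1r -unitmxE.
split=> //; exists ((invmx h)^T *m Jmx *m invmx h); split.
- by rewrite !unitmx_mul unitmx_tr unitmx_inv uh Jmx_unit.
- by rewrite -{2}[invmx h]trmxK; apply/alternating_congr/alternating_Jmx.
- by rewrite omega0_mxform act_mxform.
rewrite !invmx_mul ?unitmx_mul ?unitmx_tr ?unitmx_inv ?uh ?Jmx_unit //.
rewrite trmx_inv !invmxK invmx_Jmx /h tr_block_mx /Jmx opp_block_mx !mulmx_block.
rewrite !trmx0 !trmx1 !opprK !oppr0.
rewrite ?(mulmx0, mul0mx, mul1mx, mulmx1, addr0, add0r, mulNmx, mulmxN).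
by rewrite addrC.
Qed.

(** Indices start at 1, so [j = 0] would point to column [n], in the left half. *)
Lemma Emx_block (i j : nat) : (i <= n)%N -> (0 < j)%N ->
  Emx R (n + n) i (n + j) = block_mx 0 (Emx R n i j) 0 0.
Proof.
move=> i_n j0; apply/matrixP=> a b.
rewrite -(splitK a) -(splitK b).
case: (split a) => a' /=; case: (split b) => b' /=.
- rewrite block_mxEul !mxE /= [b'.+1 == _]ltn_eqF ?andbF //.
  by have := ltn_ord b'; lia.
- by rewrite block_mxEur !mxE /= -addnS eqn_add2l.
- rewrite block_mxEdl !mxE /= [_ == i]gtn_eqF //; lia.
- rewrite block_mxEdr !mxE /= [_ == i]gtn_eqF //; lia.
Qed.

End StandardForm.

(** * The representatives *)

Theorem proposition5p6 (R : realType) (n : nat) (hn : (2 <= n)%N) :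
  let U1 : set 'M[R]_(n + n) :=
    [set 1%:M + k *: Emx R (n + n) 2 (n + 1) | k in [set 0; 1]] in
  let U2 : set 'M[R]_(n + n) :=
    [set IPmx R n + k *: Emx R (n + n) 2 (n + 1) | k in [set 0; 1]] in
  let U3 : set 'M[R]_(n + n) :=
    [set IPmx R n + Emx R (n + n) 3 (n + 1)] in
  (n = 2%N -> set_of_representatives (@heis_bracket R n) U2) /\
  ((2 < n)%N -> set_of_representatives (@heis_bracket R n) (U1 `|` U2 `|` U3)).
Proof.
move=> U1 U2 U3.
have n0 : (0 < n)%N by lia.
have nN : (n.-1 < n)%N by lia.
(* Ordinals start at 0: [i1], [i2] and [iN] stand for the indices 1, 2 and 2n. *)
pose o1 := Ordinal n0; pose o2 := Ordinal hn; pose oN := Ordinal nN.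
pose i1 := lshift n o1; pose i2 := lshift n o2; pose iN := rshift n oN.
have i12 : i1 != i2 by [].
have i1N : i1 != iN by rewrite eq_lrshift.
have i2N : i2 != iN by rewrite eq_lrshift.
have brE x y : @heis_bracket R n x y =
    (x i1 0 * y i2 0 - y i1 0 * x i2 0) *: delta_mx iN 0.
  rewrite /heis_bracket /wedge -[1%N]/(i1.+1) -[2%N]/(i2.+1) !dual_basisE.
  congr (_ *: _); apply/colP=> a; rewrite !mxE eqxx andbT -val_eqE /=.
  by congr (nat_of_bool _)%:R; apply/eqP/eqP; lia.
have uP : Pmx R n \in unitmx by exact: unitmx_perm.
have PE X : IPmx R n + block_mx 0 X 0 0 = block_mx 1%:M X 0 (Pmx R n).
  by rewrite /IPmx add_block_mx !addr0 add0r.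
have IE X : 1%:M + block_mx 0 X 0 0 = block_mx 1%:M X 0 1%:M :> 'M[R]_(n + n).
  by rewrite scalar_mx_block add_block_mx !addr0 add0r.
have scE (k : R) i : (i <= n)%N ->
    k *: Emx R (n + n) i (n + 1) = block_mx 0 (k *: Emx R n i 1) 0 0.
  by move=> i_n; rewrite Emx_block // scale_block_mx !scaler0.
have U1P h : U1 h -> exists X Q, Q \in unitmx /\ h = block_mx 1%:M X 0 Q.
  by case=> k _ <-; rewrite scE // IE; do 2!eexists; split; first exact: unitmx1.
have U2P h : U2 h -> exists X Q, Q \in unitmx /\ h = block_mx 1%:M X 0 Q.
  by case=> k _ <-; rewrite scE // PE; do 2!eexists; split; first exact: uP.
have U3P h : (2 < n)%N -> U3 h -> exists X Q, Q \in unitmx /\ h = block_mx 1%:M X 0 Q.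
  by move=> n3 ->; rewrite Emx_block // PE; do 2!eexists; split; first exact: uP.
(* The block shape puts every h.omega_0 in Omega; it remains to reach every form from some element
   of [U]. *)
have rep (U : set 'M[R]_(n + n)) :
    (forall h, U h -> exists X Q, Q \in unitmx /\ h = block_mx 1%:M X 0 Q) ->
    (forall M, M \in unitmx -> alternating M -> exists2 h, U h &
       exists2 p, RAutset (@heis_bracket R n) p & act p (act h (@omega0 R n)) = mxform M) ->
    set_of_representatives (@heis_bracket R n) U.
  move=> UP Urep; split.
    by move=> h /UP[X [Q [uQ ->]]]; case: (act_omega0 X uQ).
  apply/seteqP; split.
    move=> _ [w /Omega_mxform[M [uM altM ->]] <-].
    have [h Uh [p Ap <-]] := Urep M uM altM.
    by exists h; rewrite // (orbit_RAut_act _ Ap).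
  move=> _ [h /UP[X [Q [uQ ->]]] <-].
  have [_ [M [uM altM -> _]]] := act_omega0 X uQ.
  by exists (mxform M) => //; exact: mxform_Omega.
have U2k k : k = 0 \/ k = 1 -> U2 (block_mx 1%:M (k *: Emx R n 2 1) 0 (Pmx R n)).
  by move=> k01; exists k => //; rewrite scE // PE.
pose W M := col_mx (delta_mx 0 i1) (delta_mx 0 i2) *m invmx M : 'M[R]_(1 + 1, n + n).
pose eN : 'rV[R]_(n + n) := delta_mx 0 iN.
have nondeg M : M \in unitmx -> alternating M -> invmx M i1 i2 != 0 ->
    exists2 h, U2 h & exists2 p, RAutset (@heis_bracket R n) p &
    act p (act h (@omega0 R n)) = mxform M.
  move=> uM altM t0.
  have [_ [M' [uM' altM' M'E KE]]] := act_omega0 (1 *: Emx R n 2 1) uP.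
  have t' : invmx M' i1 i2 = -1.
    by rewrite KE block_mxEul !mxE /= mulr0 mulr1 sub0r.
  exists (block_mx 1%:M (1 *: Emx R n 2 1) 0 (Pmx R n)); first by apply: U2k; right.
  rewrite M'E.
  have t'0 : invmx M' i1 i2 != 0 by rewrite t' oppr_eq0 oner_eq0.
  apply: (RAut_equiv_transverse i12 i1N i2N brE uM uM' altM altM' _ _
    (c := - (invmx M i1 i2)^-1)).
  - exact: W_nondegenerate_transverse.
  - exact: W_nondegenerate_transverse.
  - by rewrite oppr_eq0 invr_eq0.
  - by rewrite t' mulNr mulVf.
have contained M : M \in unitmx -> alternating M -> (eN <= W M)%MS ->
    exists2 h, U2 h & exists2 p, RAutset (@heis_bracket R n) p &
    act p (act h (@omega0 R n)) = mxform M.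
  move=> uM altM sNW.
  have [_ [M' [uM' altM' M'E KE]]] := act_omega0 (0 *: Emx R n 2 1) uP.
  exists (block_mx 1%:M (0 *: Emx R n 2 1) 0 (Pmx R n)); first by apply: U2k; left.
  rewrite M'E; apply: (RAut_equiv_contained i12 i1N i2N brE) => //.
  (* Row 1 of the inverse is zero followed by minus the first column of P. As P e_1 = e_n, this row
     is -e_2n. *)
  rewrite -/eN; suff -> : eN = - (delta_mx 0 i1 *m invmx M').
    by rewrite eqmx_opp mul_col_mx -addsmxE addsmxSl.
  rewrite -rowE KE; apply/rowP=> b; rewrite -(splitK b).
  have Pcol a : Pmx R n a o1 = (a == oN)%:R.
    have /colP/(_ a) := Pmx_basis1 R n0.
    have -> : basis_vec R n 1 = delta_mx o1 0.
      by apply/colP=> c; rewrite !mxE eqxx andbT -val_eqE.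
    rewrite -colE !mxE => ->; congr (nat_of_bool _)%:R.
    by rewrite -val_eqE /=; apply/eqP/eqP; lia.
  case: (split b) => b' /=.
    rewrite mxE [RHS]mxE [row _ _ _ _]mxE block_mxEul.
    by rewrite !mxE eq_lrshift /= !mul0r subrr oppr0.
  rewrite mxE [RHS]mxE [row _ _ _ _]mxE block_mxEur [(- _^T) _ _]mxE [_^T _ _]mxE.
  by rewrite Pcol eq_rshift opprK.
split=> [n2|n3]; apply: rep => //.
- move=> M uM altM; have [t0|] := eqVneq (invmx M i1 i2) 0; last exact: nondeg.
  by apply: contained => //; apply: isotropic_W_contained => //; lia.
- by move=> h [[/U1P|/U2P]|/(U3P _ n3)].
move=> M uM altM.
have U2sub h : U2 h -> (U1 `|` U2 `|` U3) h by left; right.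
have [t0|/(nondeg _ uM altM)[h /U2sub]] := eqVneq (invmx M i1 i2) 0; last by exists h.
have [/(contained _ uM altM)[h /U2sub]|nW] := boolP (eN <= W M)%MS; first by exists h.
have [_ [M' [uM' altM' M'E KE]]] := act_omega0 (0 *: Emx R n 2 1) (unitmx1 _ _).
exists (block_mx 1%:M (0 *: Emx R n 2 1) 0 1%:M).
  by left; left; exists 0; [left | rewrite scE // IE].
rewrite M'E.
(* Both values on W are zero, so [c = 1] works. With k = 0 and the identity block, W is spanned by
   e_(n+1) and e_(n+2), which misses e_2n because n > 2. *)
apply: (RAut_equiv_transverse i12 i1N i2N brE uM uM' altM altM' _ _ (oner_neq0 R)) => //.
  apply/negP; rewrite mul_col_mx => /sub_col_mxP[x [y /rowP/(_ iN)/eqP]].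
  have oN1 : oN == o1 = false by rewrite -val_eqE /=; lia.
  have oN2 : oN == o2 = false by rewrite -val_eqE /=; lia.
  have rN i : ((delta_mx 0 i : 'rV_(n + n)) *m invmx M') 0 iN = invmx M' i iN by rewrite -rowE mxE.
  rewrite [X in _ == X]mxE 2![(_ *: _ : 'rV__) 0 iN]mxE !rN KE !block_mxEur !mxE oN1 oN2.
  rewrite !eqxx.
  by rewrite oppr0 !mulr0 addr0 oner_eq0.
by rewrite t0 KE block_mxEul !mxE !mul0r subrr mulr0.
Qed.
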